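(* Let $\le$ be a cylinder order on $\{0,1\}^\infty$ with $[0]<[1]$. (1) If $[10^j1]<[10^j0]$ holds for at most one $j\ge0$, then $\mathbf{m}_\le=10^\infty$, and for $\mathbf{a}\in\mathcal{M}_\le$, $\mathbf{a}<\mathbf{m}_\le$ implies that $\mathbf{a}=0^\infty$ or $\mathbf{a}=(10^j)^\infty$ (the latter in case $j$ is such that $[10^j1]<[10^j0]$). (2) Otherwise, let $j,k$ be minimal such that $0\le j<k$, $[10^j1]<[10^j0]$ and $[10^k1]<[10^k0]$ (i.e., $j$ and $k$ are the smallest and second smallest integers $i\ge0$ with $[10^i1]<[10^i0]$), and define the relation $\preceq$ on $\{0,1\}^\infty$ by $\mathbf{a}\preceq\mathbf{b}$ if $\tau_{j,k}(\mathbf{a})\le\tau_{j,k}(\mathbf{b})$. Then $\preceq$ is a cylinder order on $\{0,1\}^\infty$, $[0]\prec[1]$, $\mathbf{m}_\le=\tau_{j,k}(\mathbf{m}_\preceq)$, and $$\{\mathbf{a}\in\mathcal{M}_\le : \mathbf{a}<\mathbf{m}_\le\}=\{0^\infty\}\cup\{\tau_{j,k}(\mathbf{a}) : \mathbf{a}\in\mathcal{M}_\preceq,\ \mathbf{a}\prec\mathbf{m}_\preceq\}.$$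
   Context: $\{0,1\}^\infty$ is the set of one-sided infinite words over $\{0,1\}$, with the ultrametric $d(a_1a_2\cdots,b_1b_2\cdots)=2^{-\min\{n\ge1 : a_n\ne b_n\}}$ for distinct words (and $d(\mathbf{a},\mathbf{a})=0$). A cylinder order on $\{0,1\}^\infty$ is a total order $\le$ such that $\mathbf{a}\le\mathbf{b}\le\mathbf{c}$ implies $d(\mathbf{a},\mathbf{b})\le d(\mathbf{a},\mathbf{c})$. For such an order, $s_\le(a_1a_2\cdots)=\sup_{n\ge1}a_na_{n+1}\cdots$ (supremum w.r.t. $\le$), $\mathcal{M}_\le=\{s_\le(\mathbf{a}):\mathbf{a}\in\{0,1\}^\infty\}$, and $\mathbf{m}_\le$ denotes the smallest (w.r.t. $\le$) accumulation point (w.r.t. $d$) of $\mathcal{M}_\le$. For a finite word $w$, the cylinder $[w]$ is the set of infinite words with prefix $w$. For distinct finite words $v,w$ of the same length, $[v]<[w]$ means $v^\infty<w^\infty$; equivalently $\mathbf{a}<\mathbf{b}$ for all $\mathbf{a}\in[v]$, $\mathbf{b}\in[w]$. For integers $0\le j<k$, $\tau_{j,k}$ is the substitution (word morphism, extended naturally to infinite words) given by $\tau_{j,k}(0)=10^j$, $\tau_{j,k}(1)=10^k$. *)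

(* Defs.v *)
(* The metric takes its values in the concrete reals of the standard library,
   seen as a realType through Rstruct. *)
From HB Require Import structures.
From mathcomp Require Import all_boot all_order all_algebra.
From mathcomp Require Import boolp classical_sets reals topology.
From mathcomp Require Import Rstruct.

Set Implicit Arguments.
Unset Strict Implicit.
Unset Printing Implicit Defensive.

Import Order.TTheory GRing.Theory Num.Theory.
Local Open Scope classical_set_scope.
Local Open Scope ring_scope.

Notation RR := Rdefinitions.R.

(* The letter 0 is [false] and the letter 1 is [true]; the word a_1 a_2 ... is
   the function n |-> a_{n+1}, i.e., letters are numbered from 0. *)
Definition word : Type := nat -> bool.

HB.instance Definition _ := Choice.on word.

(* The exponent is shifted by one since letters are numbered from 0. *)
Definition word_dist (a b : word) : RR :=
  if pselect (exists n, a n != b n) is left ab then 2 ^- (ex_minn ab).+1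
  else 0.

Section word_metric.
Implicit Types a b c : word.

Let word_dist_ge0 a b : 0 <= word_dist a b.
Proof.
by rewrite /word_dist; case: pselect => // ab; rewrite invr_ge0 exprn_ge0.
Qed.

Let word_distxx a : word_dist a a = 0.
Proof.
by rewrite /word_dist; case: pselect => // aa; case/negP: (svalP (cid aa)).
Qed.

Let word_dist_eq0 a b : word_dist a b = 0 -> a = b.
Proof.
rewrite /word_dist; case: pselect => [ab /eqP|nab _].
  by rewrite invr_eq0 expf_eq0 /= pnatr_eq0.
by apply/funext => n; apply/eqP/negPn/negP => abn; apply: nab; exists n.
Qed.

Let word_dist_sym a b : word_dist a b = word_dist b a.
Proof.
rewrite /word_dist; case: pselect => [ab|nab]; case: pselect => [ba|nba] //.
- by congr (2 ^- _.+1); apply: eq_ex_minn => n; rewrite eq_sym.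
- by case: nba; case: ab => n abn; exists n; rewrite eq_sym.
- by case: nab; case: ba => n ban; exists n; rewrite eq_sym.
Qed.

Let word_dist_lb a b n : a n != b n -> 2 ^- n.+1 <= word_dist a b.
Proof.
move=> abn; rewrite /word_dist; case: pselect => [ab|[]]; last by exists n.
case: ex_minnP => m _ /(_ n abn) mn.
by rewrite lef_pV2 ?posrE ?exprn_gt0// ler_eXn2l ?ltr1n.
Qed.

Let word_dist_triangle b a c :
  word_dist a c <= word_dist a b + word_dist b c.
Proof.
rewrite {1}/word_dist; case: pselect => [ac|_]; last exact: addr_ge0.
case: ex_minnP => n acn _; have [abn|abn] := eqVneq (a n) (b n).
  by apply: ler_wpDl => //; apply: word_dist_lb; rewrite -abn.
by apply: ler_wpDr => //; apply: word_dist_lb.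
Qed.

(* The topology of [word], hence [limit_point], is the one of this metric and
   not an instance on the arrow type [nat -> bool]. *)
HB.instance Definition _ := isMetric.Build RR word
  word_distxx word_dist_eq0 word_dist_sym word_dist_triangle.

End word_metric.

Definition cylinder_order (le : rel word) : Prop :=
  [/\ reflexive le, antisymmetric le, transitive le & total le] /\
  forall a b c, le a b -> le b c -> mdist a b <= mdist a c.

Definition slt (le : rel word) (a b : word) : bool := (a != b) && le a b.

Definition shift (n : nat) (a : word) : word := fun i => a (n + i)%N.

(* [is_sup le A x]: x is the supremum of A with respect to le. *)
Definition is_sup (le : rel word) (A : set word) (x : word) : Prop :=
  (forall a, A a -> le a x) /\
  (forall y, (forall a, A a -> le a y) -> le x y).

(* [is_s le a x]: x is s_le(a). *)
Definition is_s (le : rel word) (a x : word) : Prop :=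
  is_sup le (range (fun n => shift n a)) x.

Definition setM (le : rel word) : set word :=
  [set x | exists a, is_s le a x].

(* [is_m le x]: x is m_le, the smallest accumulation point of [setM le]. *)
Definition is_m (le : rel word) (x : word) : Prop :=
  limit_point (setM le) x /\
  forall y, limit_point (setM le) y -> le x y.

(* The infinite word w^oo; meaningful for a nonempty w. *)
Definition periodic (w : seq bool) : word :=
  fun n => nth false w (n %% size w).

Definition prepend (w : seq bool) (a : word) : word :=
  fun n => if (n < size w)%N then nth false w n else a (n - size w)%N.

(* [v] < [w] for distinct nonempty words v, w of the same length. *)
Definition cyl_lt (le : rel word) (v w : seq bool) : bool :=
  slt le (periodic v) (periodic w).

(* The finite word 1 0^j. *)
Definition one_zeros (j : nat) : seq bool := true :: nseq j false.

(* [1 0^j 1] < [1 0^j 0] *)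
Definition flips (le : rel word) (j : nat) : bool :=
  cyl_lt le (rcons (one_zeros j) true) (rcons (one_zeros j) false).

Definition two_smallest (P : pred nat) (j k : nat) : Prop :=
  [/\ (j < k)%N, P j, P k, (forall i, P i -> (j <= i)%N)
    & forall i, P i -> i != j -> (k <= i)%N].

(* The infinite concatenation sigma(a_1) sigma(a_2) ... for a nonerasing
   sigma: its first n+1 letters are among those of the image of the prefix
   of length n+1. *)
Definition subst_word (sigma : bool -> seq bool) (a : word) : word :=
  fun n => nth false (flatten (map sigma (mkseq a n.+1))) n.

Definition tau (j k : nat) (a : word) : word :=
  subst_word (fun b => one_zeros (if b then k else j)) a.

(* Main.v *)
Require Import Defs.
From mathcomp Require Import all_boot all_order all_algebra.
From mathcomp Require Import boolp classical_sets reals topology.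
From mathcomp Require Import Rstruct.

(** A cylinder order compares two distinct words by looking only at a pair of
    distinct prefixes of equal length ([le_prefix]). By compactness
    ([exists_sup]) a supremum of shifts of a word is approximated by these
    shifts, so [setM le] consists of the words that dominate all their own
    shifts ([setMP]). This condition is closed.

    Let [0] < [1]. A word of [setM le] other than 0^oo starts with 1. A word
    starting with 1 and lying below 10^oo starts with 1 0^l 1 for some l such
    that [10^l1] < [10^l0] ([first_block_flips]), by the definition of the
    order between these two cylinders. All the shifts of a word a of [setM le]
    are at most a, so if a < 10^oo then each of its blocks has such an l, and a
    is the image of a word under a substitution ([setM_factor]).

    If at most one j has [10^j1] < [10^j0], the only words of [setM le] below
    10^oo are thus 0^oo and possibly (10^j)^oo. These are too few to accumulate
    below 10^oo, which is itself the limit of the words (10^n)^oo of [setM le].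

    Otherwise let j < k be the two smallest such integers. A word starting with
    1 and lying below some tau(x) starts with 1 0^l 1 where l is j or k, since
    a larger l would put it above tau(x) ([block_below_tau]). Hence the words
    of [setM le] below tau(x) are 0^oo and words tau(b). As 1 0^j is a prefix of
    tau(a) for every a and the next letter is 0 exactly when a starts with 1,
    prefixes of a and of tau(a) determine each other ([eq_prefix_tau],
    [tau_eq_prefix]): this makes the order pulled back by tau a cylinder order.
    Each shift of tau(b) starts with 0 or is the image of a shift of b, so b
    belongs to the set M of the pulled-back order if and only if tau(b) belongs
    to [setM le] ([setM_tau]). Limit points below tau(x) therefore correspond as
    well, so tau maps the smallest limit point to the smallest limit point. It
    exists because the limit points form a nonempty closed set
    ([exists_is_m]). *)

Local Open Scope classical_set_scope.

(** * Prefixes *)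

Lemma eq_prefixP {n : nat} {a b : word} :
  mkseq a n = mkseq b n <-> (forall i, (i < n)%N -> a i = b i).
Proof.
split=> [ab i lin|ab]; first by rewrite -(nth_mkseq false a lin) ab nth_mkseq.
apply: (@eq_from_nth _ false) => [|i]; rewrite !size_mkseq// => lin.
by rewrite !nth_mkseq// ab.
Qed.

Lemma eq_prefixW {m n : nat} {a b : word} :
  (m <= n)%N -> mkseq a n = mkseq b n -> mkseq a m = mkseq b m.
Proof.
by move=> mn /eq_prefixP ab; apply/eq_prefixP => i /leq_trans/(_ mn)/ab.
Qed.

Lemma eq_wordP {a b : word} : (forall n, mkseq a n = mkseq b n) -> a = b.
Proof. by move=> ab; apply/funext => i; apply: (eq_prefixP.1 (ab i.+1)). Qed.

Lemma neq_wordP {a b : word} : a != b -> exists n, mkseq a n != mkseq b n.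
Proof.
move=> /eqP ab; apply: contrapT => /forallNP abn; apply: ab.
apply: eq_wordP => n.
by have /negP/negPn/eqP := abn n.
Qed.

Lemma mkseqD (a : word) (m n : nat) :
  mkseq a (m + n) = mkseq a m ++ mkseq (shift m a) n.
Proof.
rewrite /mkseq iotaD map_cat -[X in iota X n]addn0 iotaDl -map_comp.
by congr (_ ++ _); apply: eq_map.
Qed.

Lemma shiftD (m n : nat) (a : word) : shift m (shift n a) = shift (n + m) a.
Proof. by apply/funext => i; rewrite /shift addnA. Qed.

Lemma eq_prefix_shift {m n : nat} {a b : word} :
  mkseq a (m + n) = mkseq b (m + n) ->
  mkseq (shift m a) n = mkseq (shift m b) n.
Proof.
move=> /eq_prefixP ab; apply/eq_prefixP => i lin.
by apply: ab; rewrite ltn_add2l.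
Qed.

Lemma mkseq_prepend (v : seq bool) (x : word) (n : nat) :
  mkseq (prepend v x) (size v + n) = v ++ mkseq x n.
Proof.
apply: (@eq_from_nth _ false).
  by rewrite size_mkseq size_cat size_mkseq.
move=> i; rewrite size_mkseq => li; rewrite nth_mkseq//.
rewrite nth_cat /prepend; case: ltnP => // vi.
by rewrite nth_mkseq// ltn_subLR.
Qed.

Lemma mkseq_prepend_size (v : seq bool) (x : word) :
  mkseq (prepend v x) (size v) = v.
Proof. by rewrite -[size v]addn0 mkseq_prepend cats0. Qed.

Lemma shift_prepend (v : seq bool) (x : word) :
  shift (size v) (prepend v x) = x.
Proof.
by apply/funext => i; rewrite /shift /prepend ltnNge leq_addr addKn.
Qed.

Lemma prepend_mkseq (n : nat) (a : word) : prepend (mkseq a n) (shift n a) = a.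
Proof.
apply/funext => i; rewrite /prepend /shift size_mkseq.
by case: ltnP => [lin|/subnKC-> //]; rewrite nth_mkseq.
Qed.

Lemma prepend_cat (v w : seq bool) (x : word) :
  prepend (v ++ w) x = prepend v (prepend w x).
Proof.
apply/funext => i; rewrite /prepend size_cat nth_cat.
case: (ltnP i (size v)) => vi; first by rewrite ltn_addr.
by rewrite ltn_subLR// subnDA.
Qed.

Lemma mkseq_periodic (v : seq bool) : mkseq (periodic v) (size v) = v.
Proof.
apply: (@eq_from_nth _ false); rewrite size_mkseq// => i li.
by rewrite nth_mkseq// /periodic modn_small.
Qed.

Lemma periodic_prepend (v : seq bool) : v != [::] ->
  periodic v = prepend v (periodic v).
Proof.
case: v => // c v _; set w := c :: v.
apply/funext => i; rewrite /prepend /periodic; case: ltnP => wi.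
  by rewrite modn_small.
by rewrite -[in LHS](subnK wi) modnDr.
Qed.

(** * The metric and cylinder orders in terms of prefixes *)

Section metric.
Import Order.TTheory GRing.Theory Num.Theory.
Local Open Scope ring_scope.

Lemma mdist_le (n : nat) (a b : word) :
  (mdist a b <= 2 ^- n.+1) = (mkseq a n == mkseq b n).
Proof.
have -> : mdist a b = word_dist a b by [].
rewrite /word_dist; case: pselect => [ab|nab].
  rewrite lef_pV2 ?posrE ?exprn_gt0// ler_eXn2l ?ltr1n// ltnS.
  case: ex_minnP => m abm min_m; apply/idP/eqP => [nm|/eq_prefixP abn].
    apply/eq_prefixP => i lin; apply/eqP/negPn/negP => /min_m.
    by rewrite leqNgt (leq_trans lin nm).
  by rewrite leqNgt; apply: contraNN abm => /abn ->.
rewrite invr_ge0 exprn_ge0//; apply/esym/eqP/eq_prefixP => i _.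
by apply/eqP/negPn/negP => abi; apply: nab; exists i.
Qed.

Lemma mdist_dyadic (a b : word) : a != b -> exists n, mdist a b = 2 ^- n.+1.
Proof.
move=> /eqP ab; have -> : mdist a b = word_dist a b by [].
rewrite /word_dist; case: pselect => [h|nab]; first by exists (ex_minn h).
case: ab; apply/funext => i; apply/eqP/negPn/negP => abi.
by apply: nab; exists i.
Qed.

Lemma limit_pointP (A : set word) (x : word) :
  limit_point A x <->
  forall n, exists y, [/\ y != x, A y & mkseq y n = mkseq x n].
Proof.
split=> [Ax n|Ax U /nbhs_ballP[e /= e0 eU]].
  have xn : nbhs x (ball x (2 ^- n.+1 : RR)).
    by apply: nbhsx_ballx; rewrite invr_gt0 exprn_gt0.
  have [y [yx Ay]] := Ax _ xn; rewrite ballEmdist/= => /ltW.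
  by rewrite mdist_le => /eqP xy; exists y.
have [n ne] : exists n, 2 ^- n.+1 < e.
  exists (Num.bound e^-1).
  rewrite -[ltRHS]invrK ltf_pV2 ?posrE ?invr_gt0 ?exprn_gt0//.
  exact: upper_nthrootP (leqnSn _).
have [y [yx Ay xy]] := Ax n; exists y; split=> //; apply: eU.
by rewrite ballEmdist/= (le_lt_trans _ ne)// mdist_le xy.
Qed.

(** Every distance between distinct words is a power of 2, so comparing
    distances amounts to comparing the lengths of common prefixes: the metric
    condition says that cylinders are convex. *)
Lemma cylinder_orderP (le : rel word) :
  cylinder_order le <->
  [/\ reflexive le, antisymmetric le, transitive le & total le] /\
  forall n a b c, le a b -> le b c -> mkseq a n = mkseq c n ->
    mkseq a n = mkseq b n.
Proof.
split=> -[total_le convex]; (split; first exact: total_le).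
  move=> n a b c ab bc ac.
  apply/eqP; rewrite -mdist_le (le_trans (convex _ _ _ ab bc))//.
  by rewrite mdist_le ac.
move=> a b c ab bc; have [ac|/mdist_dyadic[n ac]] := eqVneq a c.
  have [_ anti _ _] := total_le; rewrite -ac in bc.
  by rewrite -ac (anti a b) ?ab.
rewrite ac mdist_le (convex n _ _ _ ab bc)//.
by apply/eqP; rewrite -mdist_le ac.
Qed.

End metric.

(** * Comparing words by their prefixes *)

Section cylinder_order.
Context {le : rel word} (cyl : cylinder_order le).

Lemma cyl_refl : reflexive le.
Proof. by case: cyl => -[]. Qed.

Lemma cyl_anti : antisymmetric le.
Proof. by case: cyl => -[]. Qed.

Lemma cyl_trans : transitive le.
Proof. by case: cyl => -[]. Qed.

Lemma cyl_total : total le.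
Proof. by case: cyl => -[]. Qed.

Lemma sltNge (a b : word) : slt le a b = ~~ le b a.
Proof.
rewrite /slt; have [->|ab /=] := eqVneq a b; first by rewrite cyl_refl.
have /orP[ab_le|ba_le] := cyl_total a b; last first.
  by rewrite ba_le; apply: contraNF ab => ab_le; rewrite (cyl_anti a b)// ab_le.
by rewrite ab_le; apply/esym; apply: contraNN ab => ba_le;
   rewrite (cyl_anti a b)// ab_le.
Qed.

Lemma leNgt (a b : word) : le a b = ~~ slt le b a.
Proof. by rewrite sltNge negbK. Qed.

Lemma sltW {a b : word} : slt le a b -> le a b.
Proof. by case/andP. Qed.

Lemma le_slt_trans {a b c : word} : le a b -> slt le b c -> slt le a c.
Proof.
by rewrite !sltNge => ab; apply: contraNN => /cyl_trans; apply.
Qed.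

Lemma slt_trans {a b c : word} : slt le a b -> slt le b c -> slt le a c.
Proof. by move=> /sltW; exact: le_slt_trans. Qed.

Lemma sltNlt {a b : word} : a != b -> slt le a b = ~~ slt le b a.
Proof. by rewrite {2}/slt eq_sym sltNge => ->. Qed.

(** Were [b] between [a] and [a'], it would lie in their common cylinder. *)
Lemma le_prefixl (n : nat) (a a' b : word) :
  mkseq a n = mkseq a' n -> mkseq a n != mkseq b n -> le a b -> le a' b.
Proof.
move=> aa' ab ab_le; rewrite leNgt; apply: contraNN ab => /sltW ba'.
have [_ convex] := (cylinder_orderP le).1 cyl.
by rewrite (convex _ _ _ _ ab_le ba' aa').
Qed.

Lemma le_prefixr (n : nat) (a b b' : word) :
  mkseq b n = mkseq b' n -> mkseq a n != mkseq b n -> le a b -> le a b'.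
Proof.
move=> bb' ab ab_le; rewrite leNgt; apply: contraNN ab => /sltW b'a.
have [_ convex] := (cylinder_orderP le).1 cyl.
by rewrite bb' (convex _ _ _ _ b'a ab_le (esym bb')).
Qed.

Lemma le_prefix {n : nat} {a b a' b' : word} :
  mkseq a n = mkseq a' n -> mkseq b n = mkseq b' n ->
  mkseq a n != mkseq b n -> le a b = le a' b'.
Proof.
move=> aa' bb' ab; apply/idP/idP => [|].
  move/(le_prefixl _ _ _ _ aa' ab)/(le_prefixr _ _ _ _ bb'); apply.
  by rewrite -aa'.
move/(le_prefixl _ _ _ _ (esym aa')); rewrite -aa' -bb' => /(_ ab).
by move/(le_prefixr _ _ _ _ (esym bb')); apply; rewrite -bb'.
Qed.

Lemma slt_prefix {n : nat} {a b a' b' : word} :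
  mkseq a n = mkseq a' n -> mkseq b n = mkseq b' n ->
  mkseq a n != mkseq b n -> slt le a b = slt le a' b'.
Proof.
by move=> aa' bb' ab; rewrite !sltNge (le_prefix bb' aa')// eq_sym.
Qed.

Lemma slt_cyl_lt (v w : seq bool) (x y : word) : size v = size w -> v != w ->
  slt le (prepend v x) (prepend w y) = cyl_lt le v w.
Proof.
move=> vw vNw; apply: (@slt_prefix (size v)).
- by rewrite mkseq_prepend_size mkseq_periodic.
- by rewrite vw mkseq_prepend_size mkseq_periodic.
- by rewrite mkseq_prepend_size vw mkseq_prepend_size.
Qed.

(** Greedy construction of a supremum: for each [n], some element of [A] lies
    in the topmost cylinder of length [n] meeting [A]; these cylinders are
    nested, hence determine the word. *)
Lemma exists_sup (A : set word) : A !=set0 ->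
  exists z, (forall a, A a -> le a z) /\
    forall n, exists2 a, A a & mkseq a n = mkseq z n.
Proof.
move=> [a0 Aa0].
pose top n a := A a /\ forall b, A b -> mkseq b n = mkseq a n \/ le b a.
have topS n a : top n a -> exists b, top n.+1 b.
  move=> [Aa topa]; have [[b [Ab ab ba]]|nb] := pselect (exists b,
      [/\ A b, slt le a b & mkseq b n.+1 != mkseq a n.+1]).
    have above c : A c -> slt le a c -> mkseq c n = mkseq a n.
      by move=> Ac; rewrite sltNge; case: (topa c Ac) => // ->.
    exists b; split=> // c Ac.
    have [cb|bc] := boolP (le c b); [by right|left].
    rewrite -sltNge in bc.
    have can := above c Ac (slt_trans ab bc); have ban := above b Ab ab.
    (* Three letters [a n], [b n], [c n] cannot be pairwise distinct. *)
    have ca : mkseq c n.+1 != mkseq a n.+1.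
      apply/eqP => ca; move: ab.
      rewrite (@slt_prefix n.+1 a b c b)//; last by rewrite eq_sym.
      by rewrite sltNge (sltW bc).
    move: ca ba; rewrite !mkseqS can ban !eqseq_rcons !eqxx /=.
    by case: (a n); case: (b n); case: (c n).
  exists a; split=> // c Ac; have [ca|ac] := boolP (le c a); [by right|left].
  apply/eqP/negPn/negP => ca; apply: nb; exists c; split=> //.
  by rewrite sltNge.
have /choice[f topf] n : exists a, top n a.
  by elim: n => [|n [a /topS //]]; exists a0; split=> // b _; left.
have topW m n a : (m <= n)%N -> top n a -> top m a.
  move=> mn [Aa topa]; split=> // b /topa[/(eq_prefixW mn)|]; first by left.
  by right.
have top_uniq n a b : top n a -> top n b -> mkseq a n = mkseq b n.
  move=> [Aa topa] [Ab topb]; have [//|ba] := topa b Ab.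
  by have [//|ab] := topb a Aa; rewrite (cyl_anti a b)// ab.
exists (fun i => f i.+1 i).
have fz n : mkseq (f n) n = mkseq (fun i => f i.+1 i) n.
  apply/eq_prefixP => i lin; have := topW i.+1 n (f n) lin (topf n).
  by move/top_uniq/(_ (topf i.+1))/eq_prefixP/(_ i (ltnSn i)).
split=> [a Aa|n]; last by exists (f n) => //; case: (topf n).
set z := (fun i => _); have [->|/neq_wordP[n an]] := eqVneq a z.
  exact: cyl_refl.
have [afn|] := (topf n).2 a Aa; first by rewrite afn fz eqxx in an.
by rewrite (@le_prefix n a (f n) a z)// fz.
Qed.

End cylinder_order.

(** * Suprema of orbits and their limit points *)

Section setM.
Context {le : rel word} (cyl : cylinder_order le).

(** If [x] is the supremum of the shifts of [a], each prefix of [x] is also one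
    of a shift of [a]. So if a shift of [x] exceeded [x], which shows on
    finitely many letters, a shift of [a] would exceed [x] as well. *)
Lemma setMP (x : word) : setM le x <-> forall n, le (shift n x) x.
Proof.
split=> [[a [ub lub]] i|x_max]; last first.
  exists x; split=> [_ [n _ <-] //|y]; apply; exists 0%N => //.
have [|z [z_ub z_adh]] := exists_sup cyl (range (shift^~ a)).
  by exists (shift 0 a); exists 0%N.
have xz : x = z.
  apply: (cyl_anti cyl); rewrite lub//= leNgt//; apply/negP => xz.
  have [n xzn] := neq_wordP (andP xz).1; have [b /ub bx bz] := z_adh n.
  by move: xz; rewrite sltNge// -(@le_prefix le cyl n b x)// ?bx// bz eq_sym.
rewrite leNgt//; apply/negP => x_lt.
have [n xn] := neq_wordP (andP x_lt).1.
have [b [m _ mb] bx] := z_adh (i + n)%N.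
have ibx : le (shift i b) x.
  by apply: ub; exists (m + i)%N; rewrite -?shiftD ?mb.
have pre_ib : mkseq (shift i b) n = mkseq (shift i x) n.
  by apply: eq_prefix_shift; rewrite bx xz.
move: x_lt; rewrite sltNge// -(@le_prefix le cyl n (shift i b) x)// ?ibx//.
by rewrite pre_ib eq_sym.
Qed.

(** A shift exceeding [y] would do so on finitely many letters, which [y] shares
    with a word of [setM le]. *)
Lemma limit_point_setM : limit_point (setM le) `<=` setM le.
Proof.
move=> y /limit_pointP ylim; apply/setMP => i.
rewrite leNgt//; apply/negP => y_lt; have [n yn] := neq_wordP (andP y_lt).1.
have [x [_ /setMP/(_ i) xM xy]] := ylim (i + n)%N.
have pre_x : mkseq x n = mkseq y n by apply: eq_prefixW xy; rewrite leq_addl.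
move: y_lt; rewrite sltNge// -(@le_prefix le cyl n (shift i x) x)// ?xM//.
  exact: eq_prefix_shift.
by rewrite (eq_prefix_shift xy) pre_x eq_sym.
Qed.

Lemma cylinder_order_dual : cylinder_order (fun a b => le b a).
Proof.
have [_ convex] := (cylinder_orderP le).1 cyl.
apply/cylinder_orderP; split.
  split=> [a|a b /andP[ba ab]|b a c ba cb|a b]; first exact: cyl_refl.
  - by apply: (cyl_anti cyl); rewrite ab.
  - exact: cyl_trans cb ba.
  - exact: cyl_total.
by move=> n a b c ba cb ac; rewrite ac (convex n c b a).
Qed.

(** The limit points form a closed set, so the word that bounds them tightly
    from below is one of them. *)
Lemma exists_is_m : limit_point (setM le) !=set0 -> exists m, is_m le m.
Proof.
move=> /(exists_sup cylinder_order_dual)[m [m_lb m_adh]].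
exists m; split=> //; apply/limit_pointP => n.
have [a alim am] := m_adh n.
have [am_eq|/neq_wordP[p amp]] := eqVneq a m.
  by move: alim; rewrite am_eq => /limit_pointP/(_ n).
(* Agreeing with [a] up to [p] keeps [y] away from [m]. *)
have [y [_ yM ya]] := (limit_pointP _ _).1 alim (maxn n p).
exists y; split=> //; last first.
  by rewrite -am; apply: eq_prefixW ya; rewrite leq_maxl.
apply: contraNneq amp => <-; apply/eqP/esym.
by apply: eq_prefixW ya; rewrite leq_maxr.
Qed.

End setM.

(** * Blocks 1 0^j *)

Notation zeros := (periodic [:: false]).
Notation one_then_zeros := (prepend [:: true] zeros).

Lemma zerosE (i : nat) : zeros i = false.
Proof. by rewrite /periodic modn1. Qed.

Lemma nth_one_zeros (j i : nat) : nth false (one_zeros j) i = (i == 0%N).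
Proof. by case: i => //= i; rewrite nth_nseq if_same. Qed.

Lemma size_one_zeros (j : nat) : size (one_zeros j) = j.+1.
Proof. by rewrite /= size_nseq. Qed.

Lemma one_then_zerosE (i : nat) : one_then_zeros i = (i == 0%N).
Proof. by rewrite /prepend; case: i => //= i; rewrite zerosE. Qed.

Lemma one_then_zeros_prepend (j : nat) :
  one_then_zeros = prepend (one_zeros j) zeros.
Proof.
apply/funext => i; rewrite one_then_zerosE {1}/prepend nth_one_zeros zerosE.
by rewrite size_one_zeros; case: ltnP => //; case: i.
Qed.

Lemma shift_periodic (w : seq bool) (i : nat) : (size w %| i)%N ->
  shift i (periodic w) = periodic w.
Proof.
move=> /dvdnP[q ->]; apply/funext => t.
by rewrite /shift /periodic modnMDl.
Qed.

Lemma one_zeros_split (l d : nat) :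
  one_zeros (l + d.+1) = rcons (one_zeros l) false ++ nseq d false.
Proof. by rewrite /one_zeros nseqD -cats1 -catA. Qed.

Lemma prepend_one_zeros_true (l : nat) (b : word) : b 0%N ->
  prepend (one_zeros l) b = prepend (rcons (one_zeros l) true) (shift 1 b).
Proof.
move=> b0; rewrite -cats1 prepend_cat; congr prepend.
by rewrite -{1}(prepend_mkseq 1 b) /mkseq /= b0.
Qed.

Lemma first_block {y : word} : y 0%N -> y != one_then_zeros ->
  exists l (y' : word), y' 0%N /\ y = prepend (one_zeros l) y'.
Proof.
move=> y0 y_neq.
have y1 : exists i, y i.+1.
  apply: contrapT => /forallNP y1; case/eqP: y_neq; apply/funext => -[|i].
    by rewrite one_then_zerosE.
  by rewrite one_then_zerosE; apply/negP/y1.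
case: (ex_minnP y1) => l yl min_l; exists l, (shift l.+1 y); split.
  by rewrite /shift addn0.
rewrite -{1}(prepend_mkseq l.+1 y); congr prepend.
apply: (@eq_from_nth _ false); rewrite size_mkseq ?size_one_zeros// => i il.
rewrite nth_mkseq// nth_one_zeros; case: i il => [|i il]; first by rewrite y0.
by apply/negP => /min_l; rewrite leqNgt -ltnS il.
Qed.

Section flips.
Context {le : rel word} (cyl : cylinder_order le).

(** The words first differ at letter [l.+1], where the first has the 1 that
    starts its next block and the second still a 0. *)
Lemma flips_slt {l i : nat} {b b' : word} : (l < i)%N -> b 0%N ->
  slt le (prepend (one_zeros l) b) (prepend (one_zeros i) b') = flips le l.
Proof.
move=> li b0; rewrite prepend_one_zeros_true// -(subnKC li) addSnnS.
rewrite one_zeros_split prepend_cat slt_cyl_lt ?size_rcons//.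
by apply/eqP => /rcons_inj[].
Qed.

Lemma flips_gt {l i : nat} {b b' : word} : (l < i)%N -> b 0%N ->
  slt le (prepend (one_zeros i) b') (prepend (one_zeros l) b) = ~~ flips le l.
Proof.
move=> li b0; rewrite -(@flips_slt l i b b' li b0); apply: (sltNlt cyl).
rewrite (@prepend_one_zeros_true l b)// -(subnKC li) addSnnS.
rewrite one_zeros_split prepend_cat.
apply/eqP => /(congr1 (fun x : word => x l.+1)).
rewrite /prepend !size_rcons size_one_zeros ltnSn.
by rewrite !nth_rcons size_one_zeros ltnn eqxx.
Qed.

(** [10^oo] starts with a longer run of 0s than [y] after the initial 1, so the
    first block of [y] alone decides the comparison. *)
Lemma first_block_flips {y : word} : y 0%N -> slt le y one_then_zeros ->
  exists l (y' : word), [/\ flips le l, y' 0%N & y = prepend (one_zeros l) y'].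
Proof.
move=> y0 y_lt; have [l [y' [y'0 yE]]] := first_block y0 (andP y_lt).1.
exists l, y'; split=> //; move: y_lt.
by rewrite yE (one_then_zeros_prepend l.+1) flips_slt.
Qed.

Context (lt01 : cyl_lt le [:: false] [:: true]).

Lemma slt01 {a b : word} : a 0%N = false -> b 0%N -> slt le a b.
Proof.
move=> a0 b0; rewrite -(prepend_mkseq 1 a) -(prepend_mkseq 1 b).
by rewrite /mkseq /= a0 b0 slt_cyl_lt.
Qed.

(** Shifts that start with 0 are automatically smaller than [x]. *)
Lemma setM_shift (x : word) : x 0%N ->
  (forall i, x i -> le (shift i x) x) -> setM le x.
Proof.
move=> x0 x_max; apply/setMP => // i.
have [/x_max//|xi] := boolP (x i); apply: sltW; apply: slt01 => //.
by rewrite /shift addn0; apply: negbTE.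
Qed.

Lemma setM_zeros : setM le zeros.
Proof.
by apply/setMP => // n; rewrite shift_periodic ?dvd1n// cyl_refl.
Qed.

Lemma setM_head_false (x : word) : setM le x -> x 0%N = false -> x = zeros.
Proof.
move=> /(setMP cyl) xM x0; apply/funext => i; rewrite zerosE; apply/negP => xi.
by move: (xM i); rewrite leNgt// slt01// /shift addn0.
Qed.

Lemma setM_periodic_one_zeros (j : nat) : setM le (periodic (one_zeros j)).
Proof.
apply: setM_shift => // i; rewrite /periodic nth_one_zeros => i0.
by rewrite -/(periodic _) shift_periodic ?cyl_refl// -/(dvdn _ _).
Qed.

(** [10^oo] is the limit of the words [(10^n)^oo]. Unlike [10^n 10^oo], these
    dominate their shifts for every cylinder order with [0] < [1]. *)
Lemma limit_point_one_then_zeros : limit_point (setM le) one_then_zeros.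
Proof.
apply/limit_pointP => n; exists (periodic (one_zeros n)); split.
- apply/eqP => /(congr1 (fun x : word => x n.+1)).
  by rewrite one_then_zerosE /periodic size_one_zeros modnn.
- exact: setM_periodic_one_zeros.
apply/eq_prefixP => i lin; rewrite one_then_zerosE /periodic nth_one_zeros.
by rewrite size_one_zeros modn_small// ltnS ltnW.
Qed.

End flips.

(** * Substitutions *)

Definition subst_seq (sigma : bool -> seq bool) (s : seq bool) : seq bool :=
  flatten (map sigma s).

Definition tau_seq (j k : nat) : seq bool -> seq bool :=
  subst_seq (fun c => one_zeros (if c then k else j)).

Section subst_word.
Context {sigma : bool -> seq bool}
  (sigma_gt0 : forall c, (0 < size (sigma c))%N).

Lemma size_subst_seq (s : seq bool) : (size s <= size (subst_seq sigma s))%N.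
Proof.
elim: s => //= c s IH; by rewrite size_cat -add1n leq_add.
Qed.

(** Each letter of [subst_word sigma a] can be read off any sufficiently long
    prefix of [a], because images of longer prefixes extend one another. *)
Lemma subst_wordE (n : nat) (a : word) :
  subst_word sigma a =
  prepend (subst_seq sigma (mkseq a n)) (subst_word sigma (shift n a)).
Proof.
have nth_subst_seq m m' i (b : word) : (i < m)%N -> (m <= m')%N ->
    nth false (subst_seq sigma (mkseq b m')) i =
    nth false (subst_seq sigma (mkseq b m)) i.
  move=> im mm'; rewrite -(subnKC mm') mkseqD.
  rewrite /subst_seq map_cat flatten_cat nth_cat.
  by rewrite (leq_trans im)// (leq_trans _ (size_subst_seq _))// size_mkseq.
apply/funext => i; rewrite /subst_word -/(subst_seq sigma _).
rewrite -(nth_subst_seq _ (n + i.+1)%N)// ?leq_addl// mkseqD.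
rewrite /subst_seq map_cat flatten_cat nth_cat /prepend; case: ltnP => // ni.
rewrite -[LHS]/(nth false (subst_seq sigma _) _).
by rewrite (nth_subst_seq _ _ _ _ (ltnSn _))// ltnS leq_subr.
Qed.

(** Reading off one block at a time determines the preimage letter by letter,
    and the blocks read exhaust the word because none is empty. *)
Lemma subst_word_factor (Q : set word) :
  (forall x, Q x -> exists c y, x = prepend (sigma c) y /\ Q y) ->
  forall x, Q x -> exists a, x = subst_word sigma a.
Proof.
move=> factor x Qx.
have /choice[f fP] (y : word) : exists p : bool * word,
    Q y -> y = prepend (sigma p.1) p.2 /\ Q p.2.
  have [/factor[c [z yE]]|nQy] := pselect (Q y); last by exists (true, y).
  by exists (c, z).
pose xs n := iter n (fun y => (f y).2) x; pose a n := (f (xs n)).1.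
have Qxs n : Q (xs n) by elim: n => //= n /fP[].
have xE n : x = prepend (subst_seq sigma (mkseq a n)) (xs n).
  elim: n => [|n IH].
    by rewrite /prepend; apply/funext => i /=; rewrite subn0.
  rewrite {1}IH mkseqS /subst_seq -cats1 map_cat flatten_cat.
  rewrite prepend_cat /= cats0.
  by congr prepend; case: (fP _ (Qxs n)).
exists a; apply/funext => i; rewrite (xE i.+1) (subst_wordE i.+1 a) /prepend.
by rewrite (leq_trans _ (size_subst_seq _))// size_mkseq.
Qed.

End subst_word.

(** Both words are fixed by prepending one more block [10^j]. *)
Lemma subst_word_const (j : nat) (a : word) :
  subst_word (fun=> one_zeros j) a = periodic (one_zeros j).
Proof.
have sz (c : bool) : (0 < size (one_zeros j))%N by rewrite size_one_zeros.
have [|b ->] := @subst_word_factor (fun=> one_zeros j) sz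
  [set periodic (one_zeros j)] _ (periodic (one_zeros j)) erefl.
  move=> _ ->; exists true, (periodic (one_zeros j)); split=> //.
  exact: periodic_prepend.
apply/funext => i; rewrite /subst_word; congr (nth _ (flatten _) _).
by rewrite -!map_comp; apply: eq_map.
Qed.

(** Every shift of [a] is at most [a], hence below [b]. So once each word below
    [b] starting with 1 begins with a block of [sigma] followed by another 1,
    all of [a] is cut into such blocks, unless [a] starts with 0. *)
Lemma setM_factor {le : rel word} (cyl : cylinder_order le)
    (lt01 : cyl_lt le [:: false] [:: true])
    {sigma : bool -> seq bool} {b : word} :
  (forall c, 0 < size (sigma c))%N ->
  (forall y : word, y 0%N -> slt le y b ->
    exists c (y' : word), y' 0%N /\ y = prepend (sigma c) y') ->
  forall a, setM le a -> slt le a b ->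
    a = zeros \/ exists c, a = subst_word sigma c.
Proof.
move=> sigma_gt0 block a aM ab.
have [a0|/negbTE a0] := boolP (a 0%N); last first.
  by left; apply: setM_head_false aM a0.
right; apply: (@subst_word_factor _ sigma_gt0
    [set y : word | y 0%N /\ exists n, y = shift n a]); last first.
  by split=> //; exists 0%N.
move=> y [y0 [n yE]]; rewrite yE in y0 *; have := (setMP cyl _).1 aM n.
move=> /(le_slt_trans cyl)/(_ ab)/(block _ y0)[c [y' [y'0 y'E]]].
exists c, y'; split=> //; split=> //; exists (n + size (sigma c))%N.
by rewrite -shiftD y'E shift_prepend.
Qed.

(** * The substitution tau *)

Section tau.
Context {j k : nat} (jk : (j < k)%N).

Lemma tauE (n : nat) (a : word) :
  tau j k a = prepend (tau_seq j k (mkseq a n)) (tau j k (shift n a)).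
Proof. by apply: subst_wordE => c; rewrite size_one_zeros. Qed.

Lemma tau_block (a : word) :
  tau j k a =
  prepend (one_zeros (if a 0%N then k else j)) (tau j k (shift 1 a)).
Proof. by rewrite {1}(tauE 1) /tau_seq /subst_seq /= cats0. Qed.

Lemma tau_head (a : word) : tau j k a 0%N.
Proof. by rewrite tau_block. Qed.

Lemma mkseq_tau_head (a : word) : mkseq (tau j k a) j.+1 = one_zeros j.
Proof.
apply: (@eq_from_nth _ false); rewrite size_mkseq ?size_one_zeros// => i ij.
rewrite nth_mkseq// tau_block /prepend size_one_zeros !nth_one_zeros.
by rewrite (leq_trans ij)//; case: (a 0%N) => //; rewrite ltnS ltnW.
Qed.

(** Both blocks begin with 1 0^j; the next letter tells them apart, as it is a 0
    in 1 0^k and the initial 1 of the following block after 1 0^j. *)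
Lemma tau_letter (n : nat) (a : word) :
  tau j k a (size (tau_seq j k (mkseq a n)) + j.+1) = ~~ a n.
Proof.
rewrite (tauE n) {1}/prepend ltnNge leq_addr addKn /= tau_block.
rewrite {1}/shift addn0 /prepend size_one_zeros nth_one_zeros.
by case: (a n); rewrite ?ltnS ?jk// ltnn subnn tau_head.
Qed.

(** The letters [10^j] gained over the image of the prefix are the common
    beginning of the two possible next blocks. With them the implication is an
    equivalence, as the converse [tau_eq_prefix] needs them to decode the last
    letter of the prefix. *)
Lemma eq_prefix_tau {n : nat} {a b : word} : mkseq a n = mkseq b n ->
  mkseq (tau j k a) (size (tau_seq j k (mkseq a n)) + j.+1) =
  mkseq (tau j k b) (size (tau_seq j k (mkseq a n)) + j.+1).
Proof.
move=> ab; rewrite {1}(tauE n a) mkseq_prepend mkseq_tau_head.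
by rewrite {1}(tauE n b) -ab mkseq_prepend mkseq_tau_head.
Qed.

Lemma tau_eq_prefix {n : nat} {a b : word} :
  mkseq (tau j k a) (size (tau_seq j k (mkseq a n)) + j.+1) =
  mkseq (tau j k b) (size (tau_seq j k (mkseq a n)) + j.+1) ->
  mkseq a n = mkseq b n.
Proof.
elim: n => // n IH.
have -> : (size (tau_seq j k (mkseq a n.+1)) =
    size (tau_seq j k (mkseq a n)) + (if a n then k else j).+1)%N.
  rewrite mkseqS /tau_seq /subst_seq -cats1 map_cat flatten_cat size_cat.
  by rewrite [flatten [seq _ | _ <- [:: a n]]]cats0 size_one_zeros.
move=> tab; have ab : mkseq a n = mkseq b n.
  by apply/IH/(eq_prefixW _ tab); rewrite leq_add2r leq_addr.
rewrite !mkseqS ab; congr rcons; apply: negb_inj.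
rewrite -(tau_letter n a) -(tau_letter n b) -ab.
by apply: (eq_prefixP.1 tab); rewrite -addnA ltn_add2l addSn ltnS leq_addl.
Qed.

Lemma tau_inj : injective (tau j k).
Proof.
by move=> a b ab; apply: eq_wordP => n; apply: tau_eq_prefix; rewrite ab.
Qed.

Lemma eq_prefix_tauW {n : nat} {a b : word} : mkseq a n = mkseq b n ->
  mkseq (tau j k a) n = mkseq (tau j k b) n.
Proof.
move=> /eq_prefix_tau; apply: eq_prefixW; apply: leq_trans (leq_addr _ _).
rewrite -{1}(size_mkseq a n); apply: size_subst_seq => c.
by rewrite size_one_zeros.
Qed.

(** A block has its only 1 at its start, so a position holding a 1 is the start
    of a block. *)
Lemma shift_tau (a : word) (i : nat) : tau j k a i ->
  exists n, shift i (tau j k a) = tau j k (shift n a).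
Proof.
elim/ltn_ind: i a => i IH a; rewrite {1}tau_block /prepend.
set s := one_zeros _; have s0 : (0 < size s)%N by rewrite size_one_zeros.
case: ltnP => [_|si].
  by rewrite nth_one_zeros => /eqP ->; exists 0%N.
have i_lt : (i - size s < i)%N by rewrite ltn_subrL s0 (leq_trans s0 si).
move=> /(IH _ i_lt)[n nE]; exists (1 + n)%N; rewrite -shiftD -nE.
by rewrite -{1}(subnKC si) -shiftD tau_block -/s shift_prepend.
Qed.

End tau.

(** * At most one flip *)

Section minimal_limit_point.
Context {le : rel word} (cyl : cylinder_order le).
Context (lt01 : cyl_lt le [:: false] [:: true]).

(** Near [0^oo] there is no other word of [setM le], so a limit point starts
    with 1, and so do the words of [setM le] close to it. *)
Lemma limit_point_below {b y : word} :
  limit_point (setM le) y -> slt le y b ->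
  y 0%N /\ forall n, exists x : word,
    [/\ x != y, setM le x, slt le x b, x 0%N & mkseq x n = mkseq y n].
Proof.
move=> ylim yb; have [p yp] := neq_wordP (andP yb).1.
have near n : exists x : word,
    [/\ x != y, setM le x, slt le x b, x 0%N = y 0%N & mkseq x n = mkseq y n].
  have [x [xy xM x_pre]] := (limit_pointP _ _).1 ylim (maxn n p).+1.
  exists x; split=> //.
  - have x_p : mkseq x p = mkseq y p.
      by apply: eq_prefixW x_pre; rewrite ltnW// ltnS leq_maxr.
    by rewrite (@slt_prefix le cyl p x b y b)// x_p.
  - exact: (eq_prefixP.1 x_pre).
  - by apply: eq_prefixW x_pre; rewrite ltnW// ltnS leq_maxl.
have y0 : y 0%N.
  apply/negPn/negP => /negbTE y0; have [x [/eqP xy xM _ x0 _]] := near 0%N.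
  apply: xy; rewrite (setM_head_false cyl lt01 y)//; last first.
    exact: limit_point_setM.
  by rewrite (setM_head_false cyl lt01 x)// x0.
split=> // n; have [x [xy xM xb x0 x_pre]] := near n.
by exists x; split=> //; rewrite x0.
Qed.

Lemma setM_below_one_then_zeros :
  (forall i j, flips le i -> flips le j -> i = j) ->
  forall a, setM le a -> slt le a one_then_zeros ->
    a = zeros \/ exists j, flips le j /\ a = periodic (one_zeros j).
Proof.
move=> uniq_flip a aM a_lt.
have [a0|/negbTE a0] := boolP (a 0%N); last first.
  by left; apply: (setM_head_false cyl).
have [j [_ [flip_j _ _]]] := first_block_flips cyl a0 a_lt.
have [|y y0 y_lt||[c ->]] := setM_factor cyl lt01 (sigma := fun=> one_zeros j)
  (b := one_then_zeros) _ _ _ aM a_lt; [by []| |by left|].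
- have [l [y' [flip_l y'0 ->]]] := first_block_flips cyl y0 y_lt.
  by exists true, y'; rewrite (uniq_flip j l).
- by right; exists j; rewrite subst_word_const.
Qed.

(** A smaller limit point would itself be in [setM le], with further words of
    [setM le] next to it, all starting with 1 and below [10^oo]. But there is at
    most one such word. *)
Lemma is_m_one_then_zeros :
  (forall i j, flips le i -> flips le j -> i = j) -> is_m le one_then_zeros.
Proof.
move=> uniq_flip; split; first exact: limit_point_one_then_zeros.
move=> y ylim; rewrite leNgt//; apply/negP => y_lt.
have [y0 /(_ 0%N)[x [xy xM x_lt x0 _]]] := limit_point_below ylim y_lt.
have below (w : word) : w 0%N -> setM le w -> slt le w one_then_zeros ->
    exists j, flips le j /\ w = periodic (one_zeros j).
  move=> w0 wM /(setM_below_one_then_zeros uniq_flip _ wM)[w_zeros|//].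
  by rewrite w_zeros in w0.
have [j [flip_j yE]] := below y y0 (limit_point_setM cyl _ ylim) y_lt.
have [l [flip_l xE]] := below x x0 xM x_lt.
by rewrite yE xE (uniq_flip l j) ?eqxx in xy.
Qed.

End minimal_limit_point.

(** * Two flips: the order pulled back by tau *)

Section renormalization.
Context {le : rel word} (cyl : cylinder_order le).
Context (lt01 : cyl_lt le [:: false] [:: true]).
Context {j k : nat} (jk : (j < k)%N).
Context (flip_j : flips le j) (flip_k : flips le k).
Context (min_k : forall i, flips le i -> i != j -> (k <= i)%N).

Let prec : rel word := fun a b => le (tau j k a) (tau j k b).

(** Convexity of cylinders is transported since prefixes of [a] and suitable
    prefixes of [tau j k a] determine each other. *)
Lemma cylinder_order_tau : cylinder_order prec.
Proof.
have [_ convex] := (cylinder_orderP le).1 cyl.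
apply/cylinder_orderP; split.
  split=> [a|a b ab|b a c|a b].
  - exact: (cyl_refl cyl).
  - exact/(tau_inj jk)/(cyl_anti cyl).
  - exact: (cyl_trans cyl).
  - exact: (cyl_total cyl).
move=> n a b c ab bc /(eq_prefix_tau jk) ac; apply: (tau_eq_prefix jk).
exact: convex ab bc ac.
Qed.

Lemma slt_tau (a b : word) : slt prec a b = slt le (tau j k a) (tau j k b).
Proof. by rewrite /slt (inj_eq (tau_inj jk)). Qed.

Lemma cyl_lt01_tau : cyl_lt prec [:: false] [:: true].
Proof.
rewrite /cyl_lt slt_tau (tau_block (periodic [:: false])).
by rewrite (tau_block (periodic [:: true])) flips_slt// tau_head.
Qed.

(** A shift of [tau j k a] starting with 1 is the image of a shift of [a]; the
    other shifts are smaller anyway. *)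
Lemma setM_tau (a : word) : setM prec a <-> setM le (tau j k a).
Proof.
split=> [/(setMP cylinder_order_tau) aM|/(setMP cyl) aM].
  apply: (setM_shift cyl lt01) => [|i]; first exact: tau_head.
  by move=> /shift_tau[n ->]; apply: aM.
apply/(setMP cylinder_order_tau) => n.
rewrite /prec -(shift_prepend (tau_seq j k (mkseq a n)) (tau j k (shift n a))).
by rewrite -tauE aM.
Qed.

(** Since [tau j k x] is below [10^oo], the first block [10^l] of [y] has
    [flips le l], hence [l] is [j] or at least [k]. In case [k < l] the flip
    at [j] or [k], whichever gives the first block of [tau j k x], would put [y]
    above [tau j k x]. *)
Lemma block_below_tau (x y : word) : y 0%N -> slt le y (tau j k x) ->
  exists c (y' : word),
    y' 0%N /\ y = prepend (one_zeros (if c then k else j)) y'.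
Proof.
move=> y0 y_lt.
have x_lt : slt le (tau j k x) one_then_zeros.
  rewrite tau_block (one_then_zeros_prepend (if x 0%N then k else j).+1).
  by rewrite flips_slt ?tau_head//; case: (x 0%N).
have [l [y' [flip_l y'0 yE]]] :=
  first_block_flips cyl y0 (slt_trans cyl y_lt x_lt).
have [lj|lj] := eqVneq l j; first by exists false, y'; rewrite yE lj.
have [kl|lk|->] := ltngtP k l; last first.
- by exists true, y'; rewrite yE.
- by move: (min_k l flip_l lj); rewrite leqNgt lk.
move: y_lt; rewrite yE tau_block flips_gt ?tau_head//.
  by case: (x 0%N); rewrite ?flip_j ?flip_k.
by case: (x 0%N) => //; apply: ltn_trans kl.
Qed.

Lemma setM_below_tau (x a : word) : setM le a -> slt le a (tau j k x) ->
  a = zeros \/ exists b, a = tau j k b.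
Proof.
apply: (setM_factor cyl lt01); first by move=> c; rewrite size_one_zeros.
exact: block_below_tau.
Qed.

(** A limit point of [setM le] below [tau j k m'] is in [setM le] and has the
    form [tau j k b], and so have the words of [setM le] close to it; decoding
    their prefixes makes [b] a limit point of [setM prec], hence at least
    [m']. *)
Lemma is_m_tau (m' : word) : is_m prec m' -> is_m le (tau j k m').
Proof.
move=> [m'_lim m'_min]; split.
  apply/limit_pointP => n.
  have [y [ym' yM y_pre]] := (limit_pointP _ _).1 m'_lim n.
  exists (tau j k y); split; first by rewrite (inj_eq (tau_inj jk)).
    exact/setM_tau.
  exact: eq_prefix_tauW.
move=> y ylim; rewrite leNgt//; apply/negP => y_lt.
have [y0 near_y] := limit_point_below cyl lt01 ylim y_lt.
have tau_of (w : word) : w 0%N -> setM le w -> slt le w (tau j k m') ->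
    exists b, w = tau j k b.
  by move=> w0 wM /(setM_below_tau _ _ wM)[w_zeros|//]; rewrite w_zeros in w0.
have [b yE] := tau_of y y0 (limit_point_setM cyl _ ylim) y_lt.
move: y_lt; rewrite sltNge// yE => /negP; apply; apply: m'_min.
apply/limit_pointP => n.
have [x [xy xM x_lt x0 x_pre]] := near_y
  (size (tau_seq j k (mkseq b n)) + j.+1)%N.
have [c xE] := tau_of x x0 xM x_lt; rewrite {}xE {}yE in xy xM x_pre.
exists c; split; first by rewrite -(inj_eq (tau_inj jk)).
  exact/setM_tau.
by apply/esym/(tau_eq_prefix jk).
Qed.

Lemma setM_below_tauE (m' : word) :
  [set a | setM le a /\ slt le a (tau j k m')] =
  [set zeros] `|` [set tau j k a | a in [set a | setM prec a /\ slt prec a m']].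
Proof.
apply/seteqP; split=> [a [aM a_lt]|a [->|[b [bM b_lt] <-]]].
- have [->|[b aE]] := setM_below_tau _ _ aM a_lt; [by left|right].
  rewrite aE in aM a_lt *.
  by exists b => //; split; [exact/setM_tau|rewrite slt_tau].
- split; first exact: setM_zeros.
  by apply: (slt01 cyl lt01); rewrite ?zerosE ?tau_head.
- by split; [exact/setM_tau|rewrite -slt_tau].
Qed.

End renormalization.

Lemma exists_two_smallest (P : pred nat) :
  ~ (forall i j, P i -> P j -> i = j) -> exists j k, two_smallest P j k.
Proof.
move=> two.
have [p [q [Pp Pq qp]]] : exists p q, [/\ P p, P q & q != p].
  apply: contrapT => none; apply: two => i j Pi Pj.
  by apply/eqP/negPn/negP => ij; apply: none; exists j, i.
have exP : exists i, P i by exists p.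
case: (ex_minnP exP) => j Pj min_j.
have exQ : exists i, P i && (i != j).
  have [pj|pj] := eqVneq p j; last by exists p; rewrite Pp.
  by exists q; rewrite Pq -pj.
case: (ex_minnP exQ) => k /andP[Pk kj] min_k.
exists j, k; split=> // [|i Pi ij]; last by apply: min_k; rewrite Pi.
by rewrite ltn_neqAle eq_sym kj min_j.
Qed.

Theorem proposition4 (le : rel word) :
  cylinder_order le -> cyl_lt le [:: false] [:: true] ->
  ((forall i j : nat, flips le i -> flips le j -> i = j) ->
     let m := prepend [:: true] (periodic [:: false]) in
     is_m le m /\
     forall a : word, setM le a -> slt le a m ->
       a = periodic [:: false] \/
       exists j : nat, flips le j /\ a = periodic (one_zeros j)) /\
  (~ (forall i j : nat, flips le i -> flips le j -> i = j) ->
     (exists j k : nat, two_smallest (flips le) j k) /\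
     forall j k : nat, two_smallest (flips le) j k ->
       let prec : rel word := fun a b => le (tau j k a) (tau j k b) in
       cylinder_order prec /\
       cyl_lt prec [:: false] [:: true] /\
       exists m m' : word,
         is_m le m /\ is_m prec m' /\ m = tau j k m' /\
         [set a | setM le a /\ slt le a m] =
         [set periodic [:: false]] `|`
           [set tau j k a | a in [set a | setM prec a /\ slt prec a m']]).
Proof.
move=> cyl lt01; split=> [uniq_flip m|two_flips].
  split; first exact: is_m_one_then_zeros.
  exact: setM_below_one_then_zeros.
split; first exact: exists_two_smallest.
move=> j k [jk flip_j flip_k _ min_k] prec.
have cyl_prec : cylinder_order prec by apply: cylinder_order_tau.
have lt01_prec : cyl_lt prec [:: false] [:: true] by apply: cyl_lt01_tau.
split=> //; split=> //.
have [|m' m'P] := exists_is_m cyl_prec.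
  exists one_then_zeros; exact: limit_point_one_then_zeros.
exists (tau j k m'), m'; split; first exact: is_m_tau.
do 2 split=> //; exact: setM_below_tauE.
Qed.
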